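(* Let $\mathcal{C}$ be a connected small category together with a free action of a group $\Gamma$ (that is, an action on $\mathcal{C}$ which is free on objects) and let $P:\mathcal{C}\to\mathcal{C}/\Gamma$ be the corresponding Galois covering (the projection functor to the orbit category). Then $\Gamma$ acts freely on $Q\mathcal{C}$ (through the induced action), and the quotient category $(Q\mathcal{C})/\Gamma$ is canonically isomorphic to $Q(\mathcal{C}/\Gamma)$. Moreover, through this canonical isomorphism the projection functor $Q\mathcal{C}\to(Q\mathcal{C})/\Gamma$ corresponds to $QP:Q\mathcal{C}\to Q(\mathcal{C}/\Gamma)$. Consequently $QP$ is a Galois covering.
   Context: All categories are small. A category is connected if its underlying undirected graph has one connected component. The set of morphisms from $x$ to $y$ in a category $\mathcal{A}$ is denoted ${}_y\mathcal{A}_x$. Fundamental groupoid: for a small category $\mathcal{B}$, $Q\mathcal{B}$ is the category of fractions obtained from $\mathcal{B}$ by formally inverting all morphisms: a groupoid with the same objects as $\mathcal{B}$, with a canonical functor $Q_{\mathcal{B}}:\mathcal{B}\to Q\mathcal{B}$, the identity on objects, such that any functor $F:\mathcal{B}\to\mathcal{D}$ sending every morphism to an invertible morphism factors uniquely as $F=F'Q_{\mathcal{B}}$. For a functor $F:\mathcal{C}\to\mathcal{B}$, $QF:Q\mathcal{C}\to Q\mathcal{B}$ is the unique functor with $(QF)Q_{\mathcal{C}}=Q_{\mathcal{B}}F$; this makes $Q$ a functor from small categories to groupoids. An action of a group $\Gamma$ on a category $\mathcal{C}$ is a group homomorphism from $\Gamma$ to the group of automorphisms of $\mathcal{C}$.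 An action of $\Gamma$ on $\mathcal{C}$ induces an action on $Q\mathcal{C}$, with $\gamma\in\Gamma$ acting by $Q$ applied to the automorphism $\gamma$ of $\mathcal{C}$; it agrees on objects with the action on $\mathcal{C}$. If the action of $\Gamma$ on objects of $\mathcal{C}$ is free, the orbit category $\mathcal{C}/\Gamma$ has as objects the $\Gamma$-orbits of objects, and as morphisms from an orbit $\omega$ to an orbit $\omega'$ the $\Gamma$-orbits of $\coprod_{x\in\omega,\,y\in\omega'}{}_y\mathcal{C}_x$, with the induced composition; the projection functor sends objects and morphisms to their orbits. Coverings: the source star (resp. target star) at an object is the set of morphisms with that source (resp. target); the star is the disjoint union of both. A functor $F:\mathcal{C}\to\mathcal{B}$ is a covering if it is surjective on objects and, for each object $c$ of $\mathcal{C}$, induces a bijection from the star at $c$ to the star at $Fc$ (equivalently, bijections between corresponding source stars and between corresponding target stars). $\mathbf{Aut}\,F$ is the group of invertible functors $H:\mathcal{C}\to\mathcal{C}$ with $FH=F$. $F$ is a Galois covering if $\mathcal{C}$ is connected and $\mathbf{Aut}\,F$ acts transitively on the objects of some (equivalently any) fibre of $F$. *)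

(* Defs.v *)
From HB Require Import structures.
From Stdlib Require Import Relation_Operators.
From mathcomp Require Import all_boot.
From mathcomp Require Import boolp classical_sets.

Set Implicit Arguments.
Unset Strict Implicit.
Unset Printing Implicit Defensive.

Local Open Scope classical_set_scope.

Record category := Category {
  obj :> Type;
  hom : obj -> obj -> Type;
  idm : forall x, hom x x;
  mcomp : forall x y z, hom y z -> hom x y -> hom x z;
  mcompA : forall x y z t (h : hom z t) (g : hom y z) (f : hom x y),
    mcomp h (mcomp g f) = mcomp (mcomp h g) f;
  mcomp1m : forall x y (f : hom x y), mcomp (idm y) f = f;
  mcompm1 : forall x y (f : hom x y), mcomp f (idm x) = f }.

Arguments hom {c} x y.
Arguments idm {c} x.
Arguments mcomp {c x y z} g f.

Definition invertible (C : category) (x y : C) (f : hom x y) :=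
  exists g : hom y x, mcomp g f = idm x /\ mcomp f g = idm y.

(* Morphisms bundled with their endpoints, so that morphisms of different
   hom-sets can be compared by an equality. *)
Record arrow (C : category) := Arrow { src : C; tgt : C; mor : hom src tgt }.

Arguments Arrow {C src tgt} mor.

Record functor (C D : category) := Functor {
  fobj :> C -> D;
  fmap : forall x y : C, hom x y -> hom (fobj x) (fobj y);
  fmap1 : forall x, fmap (idm x) = idm (fobj x);
  fmapM : forall x y z (g : hom y z) (f : hom x y),
    fmap (mcomp g f) = mcomp (fmap g) (fmap f) }.

Arguments fmap {C D} f {x y} _ : rename.

Lemma Arrow_inj (C : category) (x y : C) (f g : hom x y) :
  Arrow f = Arrow g -> f = g.
Proof.
have gen (a b : arrow C) : a = b -> exists (p : src a = src b)
    (q : tgt a = tgt b),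
    eq_rect _ (fun u => hom u (tgt b))
      (eq_rect _ (fun v => hom (src a) v) (mor a) _ q) _ p = mor b.
  by move=> ->; exists erefl, erefl.
move=> /gen /= [p [q]].
by rewrite (Prop_irrelevance p erefl) (Prop_irrelevance q erefl).
Qed.

Lemma functor_eq (C D : category) (F G : functor C D) :
  (forall (x y : C) (f : hom x y), Arrow (fmap F f) = Arrow (fmap G f)) ->
  F = G.
Proof.
move=> FG.
have FGo : fobj F = fobj G.
  by apply: funext => x; exact: (congr1 (@src D) (FG x x (idm x))).
case: F G FGo FG => [F0 F1 F2 F3] [G0 G1 G2 G3] /= FGo; subst G0 => FG.
have FG1 : F1 = G1.
  apply: functional_extensionality_dep => x.
  apply: functional_extensionality_dep => y.
  by apply: funext => f; exact: (Arrow_inj (FG _ _ f)).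
subst G1; congr Functor; exact: Prop_irrelevance.
Qed.

Definition fid (C : category) : functor C C :=
  @Functor C C (fun x => x) (fun x y f => f) (fun x => erefl)
    (fun x y z g f => erefl).

Definition fcomp (C D E : category) (G : functor D E) (F : functor C D) :
  functor C E.
Proof.
refine (@Functor C E (fun x => G (F x)) (fun x y f => fmap G (fmap F f)) _ _).
- by move=> x; rewrite !fmap1.
- by move=> x y z g f; rewrite !fmapM.
Defined.

Lemma fcompA (C D E K : category) (H : functor E K) (G : functor D E)
    (F : functor C D) : fcomp H (fcomp G F) = fcomp (fcomp H G) F.
Proof. exact: functor_eq. Qed.

Lemma fcomp1f (C D : category) (F : functor C D) : fcomp (fid D) F = F.
Proof. exact: functor_eq. Qed.

Lemma fcompf1 (C D : category) (F : functor C D) : fcomp F (fid C) = F.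
Proof. exact: functor_eq. Qed.

Definition is_isomorphism (C D : category) (F : functor C D) :=
  exists G : functor D C, fcomp G F = fid C /\ fcomp F G = fid D.

(* Exactly one connected component: in particular the empty category is not
   connected. *)
Definition connected (C : category) :=
  inhabited C /\
  forall x y : C, clos_refl_sym_trans C (fun u v => inhabited (hom u v)) x y.

Record autom (C : category) := Autom {
  aut_fun :> functor C C;
  aut_inv : functor C C;
  aut_funK : fcomp aut_inv aut_fun = fid C;
  aut_invK : fcomp aut_fun aut_inv = fid C }.

Lemma autom_eq (C : category) (a b : autom C) :
  aut_fun a = aut_fun b -> a = b.
Proof.
case: a b => [a a' aK a'K] [b b' bK b'K] /= ab; subst b.
have ab' : a' = b' by rewrite -(fcompf1 a') -b'K fcompA aK fcomp1f.
subst b'; congr Autom; exact: Prop_irrelevance.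
Qed.

HB.instance Definition _ (C : category) := gen_eqMixin (autom C).
HB.instance Definition _ (C : category) := gen_choiceMixin (autom C).

Section AutomGroup.
Variable C : category.
Implicit Types a b c : autom C.

Definition aut_one : autom C := Autom (fcomp1f (fid C)) (fcomp1f (fid C)).

Definition aut_mul a b : autom C.
Proof.
refine (@Autom C (fcomp a b) (fcomp (aut_inv b) (aut_inv a)) _ _).
- by rewrite fcompA -(fcompA (aut_inv b)) aut_funK fcompf1 aut_funK.
- by rewrite fcompA -(fcompA a) aut_invK fcompf1 aut_invK.
Defined.

Definition aut_opp a : autom C := Autom (aut_invK a) (aut_funK a).

Lemma aut_mulA : associative aut_mul.
Proof. by move=> a b c; apply: autom_eq; exact: fcompA. Qed.
Lemma aut_mul1l : left_id aut_one aut_mul.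
Proof. by move=> a; apply: autom_eq; exact: fcomp1f. Qed.
Lemma aut_mul1r : right_id aut_one aut_mul.
Proof. by move=> a; apply: autom_eq; exact: fcompf1. Qed.
Lemma aut_mulVl : left_inverse aut_one aut_opp aut_mul.
Proof. by move=> a; apply: autom_eq; exact: aut_funK. Qed.
Lemma aut_mulVr : right_inverse aut_one aut_opp aut_mul.
Proof. by move=> a; apply: autom_eq; exact: aut_invK. Qed.
End AutomGroup.

HB.instance Definition _ (C : category) :=
  isGroup.Build (autom C) (@aut_mulA C) (@aut_mul1l C) (@aut_mul1r C)
    (@aut_mulVl C) (@aut_mulVr C).

Section Quotient.
Variables (T : Type) (R : T -> T -> Prop).

Definition quot := {A : set T | exists x, A = R x}.

Definition cls (x : T) : quot := exist _ (R x : set T) (ex_intro _ x erefl).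

Lemma quot_eq (q r : quot) : sval q = sval r -> q = r.
Proof. by case: q r => [A p] [B q] /= AB; exact: eq_exist. Qed.

Definition repr (q : quot) : T := sval (cid (proj2_sig q)).

Lemma reprK (q : quot) : cls (repr q) = q.
Proof. by apply: quot_eq; rewrite /repr; case: cid => x /= ->. Qed.

Hypotheses (Rxx : forall x, R x x) (Rsym : forall x y, R x y -> R y x).
Hypothesis Rtrans : forall x y z, R x y -> R y z -> R x z.

Lemma clsP (x y : T) : cls x = cls y <-> R x y.
Proof.
split=> [/(congr1 sval) /= -> // | Rxy].
apply: quot_eq; apply/predeqP => z /=; split; apply: Rtrans => //.
exact: Rsym.
Qed.

Lemma repr_cls (x : T) : R (repr (cls x)) x.
Proof. by apply/clsP; rewrite reprK. Qed.
End Quotient.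

Section Fractions.
Variable B : category.

(* Formal composites of morphisms of B and of formal inverses of such. *)
Inductive fterm : B -> B -> Type :=
| ft_gen x y : hom x y -> fterm x y
| ft_inv x y : hom x y -> fterm y x
| ft_id x : fterm x x
| ft_comp x y z : fterm y z -> fterm x y -> fterm x z.

Inductive fequiv : forall x y : B, fterm x y -> fterm x y -> Prop :=
| fe_refl x y (t : fterm x y) : fequiv t t
| fe_sym x y (t u : fterm x y) : fequiv t u -> fequiv u t
| fe_trans x y (t u v : fterm x y) : fequiv t u -> fequiv u v -> fequiv t v
| fe_congr x y z (t t' : fterm y z) (u u' : fterm x y) :
    fequiv t t' -> fequiv u u' -> fequiv (ft_comp t u) (ft_comp t' u')
| fe_assoc x y z w (t : fterm z w) (u : fterm y z) (v : fterm x y) :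
    fequiv (ft_comp t (ft_comp u v)) (ft_comp (ft_comp t u) v)
| fe_idl x y (t : fterm x y) : fequiv (ft_comp (ft_id y) t) t
| fe_idr x y (t : fterm x y) : fequiv (ft_comp t (ft_id x)) t
| fe_gen1 x : fequiv (ft_gen (idm x)) (ft_id x)
| fe_genM x y z (g : hom y z) (f : hom x y) :
    fequiv (ft_gen (mcomp g f)) (ft_comp (ft_gen g) (ft_gen f))
| fe_invl x y (f : hom x y) : fequiv (ft_comp (ft_inv f) (ft_gen f)) (ft_id x)
| fe_invr x y (f : hom x y) : fequiv (ft_comp (ft_gen f) (ft_inv f)) (ft_id y).

Definition fhom (x y : B) := quot (@fequiv x y).

Definition fcls x y (t : fterm x y) : fhom x y := cls (@fequiv x y) t.

Lemma fclsP x y (t u : fterm x y) : fcls t = fcls u <-> fequiv t u.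
Proof. apply: clsP; [exact: fe_refl | exact: fe_sym | exact: fe_trans]. Qed.

Lemma repr_fcls x y (t : fterm x y) : fequiv (repr (fcls t)) t.
Proof. by apply/fclsP; exact: reprK. Qed.

Definition fhom_comp x y z (g : fhom y z) (f : fhom x y) : fhom x z :=
  fcls (ft_comp (repr g) (repr f)).

Lemma fhom_compE x y z (t : fterm y z) (u : fterm x y) :
  fhom_comp (fcls t) (fcls u) = fcls (ft_comp t u).
Proof. by apply/fclsP; apply: fe_congr; exact: repr_fcls. Qed.

Lemma fcls_ind x y (P : fhom x y -> Prop) :
  (forall t, P (fcls t)) -> forall f, P f.
Proof. by move=> Pt f; rewrite -(reprK f); exact: Pt. Qed.

Definition fractions : category.
Proof.
refine (@Category B fhom (fun x => fcls (ft_id x)) fhom_comp _ _ _).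
- move=> x y z t; elim/fcls_ind=> h; elim/fcls_ind=> g; elim/fcls_ind=> f.
  by rewrite !fhom_compE; apply/fclsP; exact: fe_assoc.
- by move=> x y; elim/fcls_ind=> f; rewrite fhom_compE; apply/fclsP/fe_idl.
- by move=> x y; elim/fcls_ind=> f; rewrite fhom_compE; apply/fclsP/fe_idr.
Defined.

Definition Qcan : functor B fractions.
Proof.
refine (@Functor B fractions (fun x => x) (fun x y f => fcls (ft_gen f)) _ _).
- by move=> x; apply/fclsP; exact: fe_gen1.
- by move=> x y z g f; rewrite /= fhom_compE; apply/fclsP; exact: fe_genM.
Defined.

Lemma Qcan_invertible (x y : B) (f : hom x y) : invertible (fmap Qcan f).
Proof.
exists (fcls (ft_inv f)); rewrite /= !fhom_compE.
by split; apply/fclsP; [exact: fe_invl | exact: fe_invr].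
Qed.

Lemma fractions_groupoid (x y : fractions) (f : hom x y) : invertible f.
Proof.
elim/fcls_ind: f => t; elim: t => {x y}.
- by move=> x y f; exact: Qcan_invertible.
- move=> x y f; exists (fcls (ft_gen f)); rewrite /= !fhom_compE.
  by split; apply/fclsP; [exact: fe_invr | exact: fe_invl].
- by move=> x; exists (idm (x : fractions)); rewrite !(@mcomp1m fractions).
- move=> x y z t [t' [t't tt']] u [u' [u'u uu']].
  exists (@mcomp fractions _ _ _ u' t').
  rewrite -fhom_compE -/(@mcomp fractions _ _ _ (fcls t) (fcls u)).
  split.
    by rewrite !mcompA -(mcompA u') t't mcompm1.
  by rewrite !mcompA -(mcompA (fcls t : @hom fractions y z)) uu' mcompm1.
Qed.

Section UniversalProperty.
Variables (D : category) (F : functor B D).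
Hypothesis Finv : forall (x y : B) (f : hom x y), invertible (fmap F f).

Fixpoint fterm_eval x y (t : fterm x y) : hom (F x) (F y) :=
  match t with
  | ft_gen _ _ f => fmap F f
  | ft_inv _ _ f => sval (cid (Finv f))
  | ft_id x => idm (F x)
  | ft_comp _ _ _ t u => mcomp (fterm_eval t) (fterm_eval u)
  end.

Lemma fterm_eval_equiv x y (t u : fterm x y) :
  fequiv t u -> fterm_eval t = fterm_eval u.
Proof.
elim=> {x y t u} //=.
- by move=> x y t u v _ -> _ ->.
- by move=> x y z t t' u u' _ -> _ ->.
- by move=> *; rewrite mcompA.
- by move=> *; rewrite mcomp1m.
- by move=> *; rewrite mcompm1.
- by move=> *; rewrite fmap1.
- by move=> *; rewrite fmapM.
- by move=> x y f; case: cid => g [].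
- by move=> x y f; case: cid => g [].
Qed.

Definition Qlift : functor fractions D.
Proof.
refine (@Functor fractions D (fun x => F x) (fun x y f => fterm_eval (repr f))
  _ _).
- by move=> x; rewrite (fterm_eval_equiv (repr_fcls _)).
- by move=> x y z g f; rewrite (fterm_eval_equiv (repr_fcls _)).
Defined.

Lemma Qlift_can : fcomp Qlift Qcan = F.
Proof.
by apply: functor_eq => x y f /=; rewrite (fterm_eval_equiv (repr_fcls _)).
Qed.

End UniversalProperty.

Lemma inverse_unique (D : category) (x y : D) (f : hom x y) (g h : hom y x) :
  mcomp g f = idm x -> mcomp f h = idm y -> g = h.
Proof. by move=> gf fh; rewrite -(mcompm1 g) -fh mcompA gf mcomp1m. Qed.

Lemma Qcan_epi (D : category) (G H : functor fractions D) :
  fcomp G Qcan = fcomp H Qcan -> G = H.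
Proof.
move=> GH; apply: functor_eq => x y; elim/fcls_ind=> t.
have GHo (z : B) : fobj G z = fobj H z.
  exact: (congr1 (fun K : functor B D => fobj K z) GH).
case: G H GH GHo => [G0 G1 G2 G3] [H0 H1 H2 H3] /= GH GHo.
have {GHo} GHo : G0 = H0 by apply: funext => z; exact: GHo.
subst H0.
have GH1 (z w : B) (f : hom z w) :
    G1 z w (fcls (ft_gen f)) = H1 z w (fcls (ft_gen f)).
  apply: Arrow_inj.
  exact: (congr1 (fun K : functor B D => Arrow (fmap K f)) GH).
congr Arrow; elim: t => {x y}; first exact: GH1.
- move=> z w f.
  apply: (@inverse_unique _ _ _ (G1 z w (fcls (ft_gen f)))).
    rewrite -G3 /= fhom_compE -G2 /=; congr G1.
    by apply/fclsP; exact: fe_invl.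
  rewrite GH1 -H3 /= fhom_compE -H2 /=; congr H1.
  by apply/fclsP; exact: fe_invr.
- by move=> z; rewrite (G2 z) (H2 z).
- move=> z w v t IHt u IHu; rewrite -fhom_compE.
  by rewrite (G3 z w v) (H3 z w v) IHt IHu.
Qed.

Theorem fractions_universal (D : category) (F : functor B D) :
  (forall (x y : B) (f : hom x y), invertible (fmap F f)) ->
  exists! F' : functor fractions D, fcomp F' Qcan = F.
Proof.
move=> Finv; exists (Qlift Finv); split; first exact: Qlift_can.
by move=> G GF; apply: Qcan_epi; rewrite Qlift_can.
Qed.

End Fractions.

Section Qfunctor.

Lemma Qcan_comp_invertible (C B : category) (F : functor C B) (x y : C)
  (f : hom x y) : invertible (fmap (fcomp (Qcan B) F) f).
Proof. exact: Qcan_invertible. Qed.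

(* The unique functor with Qmap F o Qcan C = Qcan B o F: see Qmap_can and
   Qcan_epi. *)
Definition Qmap (C B : category) (F : functor C B) :
    functor (fractions C) (fractions B) :=
  Qlift (@Qcan_comp_invertible C B F).

Lemma Qmap_can (C B : category) (F : functor C B) :
  fcomp (Qmap F) (Qcan C) = fcomp (Qcan B) F.
Proof. exact: Qlift_can. Qed.

Lemma Qmap_id (C : category) : Qmap (fid C) = fid (fractions C).
Proof. by apply: Qcan_epi; rewrite Qmap_can fcompf1 fcomp1f. Qed.

Lemma Qmap_comp (C D E : category) (G : functor D E) (F : functor C D) :
  Qmap (fcomp G F) = fcomp (Qmap G) (Qmap F).
Proof.
by apply: Qcan_epi; rewrite Qmap_can -fcompA Qmap_can !fcompA Qmap_can.
Qed.

Definition Qaut (C : category) (a : autom C) : autom (fractions C).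
Proof.
refine (@Autom _ (Qmap a) (Qmap (aut_inv a)) _ _).
- by rewrite -Qmap_comp aut_funK Qmap_id.
- by rewrite -Qmap_comp aut_invK Qmap_id.
Defined.

End Qfunctor.

Notation action Gamma C := (UMagmaMorphism.type Gamma (autom C)).

Section InducedAction.
Variables (Gamma : groupType) (C : category) (act : action Gamma C).

Definition Qact_fun (g : Gamma) : autom (fractions C) := Qaut (act g).

Lemma Qact_is_morphism : monoid_morphism Qact_fun.
Proof.
split=> [|g h]; apply: autom_eq; rewrite /= ?gmulf1 ?gmulfM.
  exact: Qmap_id.
exact: Qmap_comp.
Qed.

HB.instance Definition _ :=
  isUMagmaMorphism.Build Gamma (autom (fractions C)) Qact_fun
    Qact_is_morphism.

Definition Qact : action Gamma (fractions C) := Qact_fun.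

End InducedAction.

Definition acts_freely (Gamma : groupType) (C : category)
    (act : action Gamma C) :=
  forall (g : Gamma) (x : C), act g x = x -> g = 1%g.

Section OrbitCategory.
Variables (Gamma : groupType) (C : category) (act : action Gamma C).

Definition obj_orbit (x : C) : set C := [set y | exists g, y = act g x].

Definition arrow_act (g : Gamma) (a : arrow C) : arrow C :=
  Arrow (fmap (act g) (mor a)).

Definition arrow_orbit (a : arrow C) : set (arrow C) :=
  [set b | exists g, b = arrow_act g a].

Definition orbits := quot obj_orbit.

(* The morphisms with source in w and target in w' are stable under Gamma, so
   the orbits they form are orbits of the action on all arrows of C. *)
Definition orbit_hom (w w' : orbits) :=
  {M : set (arrow C) | exists a,
    [/\ M = arrow_orbit a, sval w (src a) & sval w' (tgt a)]}.

Lemma act1 (x : C) : act 1%g x = x.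
Proof. by rewrite gmulf1. Qed.

Lemma actM (g h : Gamma) (x : C) : act (g * h)%g x = act g (act h x).
Proof. by rewrite gmulfM. Qed.

Lemma actK (g : Gamma) (x : C) : act g^-1%g (act g x) = x.
Proof. by rewrite -actM mulVg act1. Qed.

Lemma arrow_act1 (a : arrow C) : arrow_act 1%g a = a.
Proof. by rewrite /arrow_act gmulf1; case: a. Qed.

Lemma arrow_actM (g h : Gamma) (a : arrow C) :
  arrow_act (g * h)%g a = arrow_act g (arrow_act h a).
Proof. by rewrite /arrow_act gmulfM. Qed.

Lemma obj_orbitP (x y : C) :
  cls obj_orbit x = cls obj_orbit y <-> obj_orbit x y.
Proof.
apply: clsP => [z|z t [g ->]|z t u [g ->] [h ->]].
- by exists 1%g; rewrite act1.
- by exists g^-1%g; rewrite actK.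
- by exists (h * g)%g; rewrite actM.
Qed.

Lemma orbit_transitive (w : orbits) (x y : C) :
  sval w x -> sval w y -> exists g, y = act g x.
Proof.
case: w => w /= [z ->] zx zy; apply/obj_orbitP.
by move/obj_orbitP: zx => <-; apply/obj_orbitP.
Qed.

Lemma orbit_act (w : orbits) (x : C) (g : Gamma) :
  sval w x -> sval w (act g x).
Proof.
by case: w => w /= [z ->] [h ->]; exists (g * h)%g; rewrite actM.
Qed.

Lemma arrow_orbit_refl (a : arrow C) : arrow_orbit a a.
Proof. by exists 1%g; rewrite arrow_act1. Qed.

Lemma arrow_orbit_act (g : Gamma) (a : arrow C) :
  arrow_orbit (arrow_act g a) = arrow_orbit a.
Proof.
apply/predeqP => b; split=> [[h ->]|[h ->]].
  by exists (h * g)%g; rewrite arrow_actM.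
by exists (h * g^-1)%g; rewrite -arrow_actM -mulgA mulVg mulg1.
Qed.

Lemma orbit_hom_eq (w w' : orbits) (M N : orbit_hom w w') :
  sval M = sval N -> M = N.
Proof. by case: M N => [M p] [N q] /= MN; exact: eq_exist. Qed.

(* When M and N are orbits whose target and source orbits agree, freeness makes
   this set a single orbit: see orbit_comp_setE. *)
Definition orbit_comp_set (N M : set (arrow C)) : set (arrow C) :=
  [set h | exists (x y z : C) (g : hom y z) (f : hom x y),
    [/\ N (Arrow g), M (Arrow f) & h = Arrow (mcomp g f)]].

Hypothesis free : acts_freely act.

Lemma act_inj (g h : Gamma) (x : C) : act g x = act h x -> g = h.
Proof.
move=> gh; have : (h^-1 * g)%g = 1%g.
  by apply: (@free _ x); rewrite actM gh actK.
by move/(congr1 (fun k => h * k)%g); rewrite mulgA mulgV mul1g mulg1.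
Qed.

Lemma orbit_comp_setE (x y z : C) (g : hom y z) (f : hom x y) :
  orbit_comp_set (arrow_orbit (Arrow g)) (arrow_orbit (Arrow f)) =
  arrow_orbit (Arrow (mcomp g f)).
Proof.
apply/predeqP => h; split; last first.
  case=> k ->; exists (act k x), (act k y), (act k z).
  exists (fmap (act k) g), (fmap (act k) f).
  by split; [exists k | exists k | rewrite /arrow_act /= fmapM].
case=> x' [y' [z' [g' [f' [[k kg] [l lf] ->]]]]].
have kl : k = l.
  apply: (@act_inj _ _ y).
  have /= <- := congr1 (@src C) kg.
  by have /= <- := congr1 (@tgt C) lf.
subst l; exists k; rewrite /arrow_act /= fmapM.
move: kg lf; rewrite /arrow_act /=.
move: (fmap (act k) g) (fmap (act k) f) => g1 f1 kg lf.
have ey := congr1 (@src C) kg; have ez := congr1 (@tgt C) kg.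
have ex := congr1 (@src C) lf.
rewrite /= in ex ey ez; subst x' y' z'.
by rewrite (Arrow_inj kg) (Arrow_inj lf).
Qed.

Lemma orbit_hom_pair (w w' w'' : orbits) (N : orbit_hom w' w'')
    (M : orbit_hom w w') :
  exists (x y z : C) (g : hom y z) (f : hom x y),
    [/\ sval N = arrow_orbit (Arrow g), sval M = arrow_orbit (Arrow f),
        sval w x, sval w' y & sval w'' z].
Proof.
case: M N => [M [[x y f] [/= -> wx wy]]] [N [b [/= -> wb wb']]].
have [k /= yE] := orbit_transitive wb wy.
exists x, y.
move: (arrow_orbit_act k b) (orbit_act k wb') (esym yE).
rewrite -[act k (src b)]/(src (arrow_act k b)).
rewrite -[act k (tgt b)]/(tgt (arrow_act k b)).
move: (arrow_act k b) => [y' z g] /= gb wz ey; subst y'.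
by exists z, g, f; rewrite gb; split.
Qed.

Lemma orbit_comp_subproof (w w' w'' : orbits) (N : orbit_hom w' w'')
    (M : orbit_hom w w') :
  exists a, [/\ orbit_comp_set (sval N) (sval M) = arrow_orbit a,
    sval w (src a) & sval w'' (tgt a)].
Proof.
have [x [y [z [g [f [-> -> wx _ wz]]]]]] := orbit_hom_pair N M.
by exists (Arrow (mcomp g f)); rewrite orbit_comp_setE; split.
Qed.

Definition orbit_comp (w w' w'' : orbits) (N : orbit_hom w' w'')
    (M : orbit_hom w w') : orbit_hom w w'' :=
  exist _ (orbit_comp_set (sval N) (sval M)) (orbit_comp_subproof N M).

Definition orbit_id_set (w : orbits) : set (arrow C) :=
  [set h | exists2 x : C, sval w x & h = Arrow (idm x)].

Lemma orbit_id_setE (w : orbits) (x : C) :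
  sval w x -> orbit_id_set w = arrow_orbit (Arrow (idm x)).
Proof.
move=> wx; apply/predeqP => h; split=> [[y wy ->]|[k ->]].
  have [k ->] := orbit_transitive wx wy.
  by exists k; rewrite /arrow_act /= fmap1.
by exists (act k x); [exact: orbit_act | rewrite /arrow_act /= fmap1].
Qed.

Lemma orbit_id_subproof (w : orbits) :
  exists a, [/\ orbit_id_set w = arrow_orbit a,
    sval w (src a) & sval w (tgt a)].
Proof.
have [x wx] : exists x, sval w x.
  by case: w => w /= [x ->]; exists x, 1%g; rewrite act1.
by exists (Arrow (idm x)); split=> //; exact: orbit_id_setE.
Qed.

Definition orbit_id (w : orbits) : orbit_hom w w :=
  exist _ (orbit_id_set w) (orbit_id_subproof w).

Definition orbit_cat : category.
Proof.
refine (@Category orbits orbit_hom orbit_id orbit_comp _ _ _).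
- move=> w1 w2 w3 w4 P N M; apply: orbit_hom_eq => /=.
  apply/predeqP => h; split.
  + case=> x [y [t [p [q [Pp [x' [y' [z' [n [m [Nn Mm e]]]]]] hE]]]]].
    have ex := congr1 (@src C) e; have ez := congr1 (@tgt C) e.
    rewrite /= in ex ez; subst x' z'.
    rewrite (Arrow_inj e) mcompA in hE.
    by exists x, y', t, (mcomp p n), m; split=> //; exists y', y, t, p, n.
  + case=> x [y [t [q [m [[y' [z' [t' [p [n [Pp Nn e]]]]]] Mm hE]]]]].
    have ex := congr1 (@src C) e; have ez := congr1 (@tgt C) e.
    rewrite /= in ex ez; subst y' t'.
    rewrite (Arrow_inj e) -mcompA in hE.
    by exists x, z', t, p, (mcomp n m); split=> //; exists x, y, z', n, m.
- move=> w w' M; apply: orbit_hom_eq => /=.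
  case: M => M [[x y f] [/= -> wx wy]].
  by rewrite (orbit_id_setE wy) orbit_comp_setE mcomp1m.
- move=> w w' M; apply: orbit_hom_eq => /=.
  case: M => M [[x y f] [/= -> wx wy]].
  by rewrite (orbit_id_setE wx) orbit_comp_setE mcompm1.
Defined.

Lemma proj_hom_subproof (x y : C) (f : hom x y) :
  exists a, [/\ arrow_orbit (Arrow f) = arrow_orbit a,
    obj_orbit x (src a) & obj_orbit y (tgt a)].
Proof. by exists (Arrow f); split=> //; exists 1%g; rewrite act1. Qed.

Definition proj : functor C orbit_cat.
Proof.
refine (@Functor C orbit_cat (cls obj_orbit)
  (fun x y f => exist _ (arrow_orbit (Arrow f)) (proj_hom_subproof f)) _ _).
- move=> x; apply: orbit_hom_eq => /=; apply/esym/orbit_id_setE.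
  by exists 1%g; rewrite act1.
- move=> x y z g f; apply: orbit_hom_eq => /=.
  by rewrite orbit_comp_setE.
Defined.

End OrbitCategory.

Definition source_star (C : category) (c : C) := {y : C & hom c y}.
Definition target_star (C : category) (c : C) := {x : C & hom x c}.
Definition star (C : category) (c : C) := (source_star c + target_star c)%type.

Definition star_map (C B : category) (F : functor C B) (c : C)
    (s : star c) : star (F c) :=
  match s with
  | inl s => inl (existT (fun y => hom (F c) y) (F (tag s))
                    (fmap F (tagged s)))
  | inr s => inr (existT (fun x => hom x (F c)) (F (tag s))
                    (fmap F (tagged s)))
  end.

Definition is_covering (C B : category) (F : functor C B) :=
  (forall b : B, exists c : C, F c = b) /\
  (forall c : C, bijective (@star_map C B F c)).

Definition deck (C B : category) (F : functor C B) : set (autom C) :=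
  [set H : autom C | fcomp F H = F].

(* Transitivity is asked on every fibre; for a covering with connected domain
   this is equivalent to transitivity on one fibre. *)
Definition is_Galois_covering (C B : category) (F : functor C B) :=
  [/\ is_covering F, connected C &
      forall (b : B) (x y : C), F x = b -> F y = b ->
        exists2 H : autom C, deck F H & H x = y].

(* Main.v *)
Require Import Defs.
From mathcomp Require Import all_boot.
From Stdlib Require Import Relation_Operators.
From mathcomp Require Import boolp classical_sets.

Set Implicit Arguments.
Unset Strict Implicit.
Unset Printing Implicit Defensive.

(** A free quotient P : C -> C/Gamma is universal among the functors on C that
    are invariant under Gamma, while Q is universal among the functors that
    invert all morphisms.  Hence (QC)/Gamma and Q(C/Gamma) both represent the
    Gamma-invariant functors on C inverting all morphisms, which gives the
    canonical isomorphism.  A free quotient of a connected category is a Galois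
    covering, and this property is transported from QC -> (QC)/Gamma to QP
    along the isomorphism. *)

(** * Functors acting on bundled arrows *)

Definition functor_arrow (C D : category) (F : functor C D) (a : arrow C) :
  arrow D := Arrow (fmap F (mor a)).

(** Retypes a morphism whose endpoints agree only propositionally with the wanted ones, without
    explicit transport. *)
Lemma arrow_hom (C : category) (x y : C) (a : arrow C) :
  src a = x -> tgt a = y -> exists f : hom x y, Arrow f = a.
Proof. by case: a => u v f /= <- <-; exists f. Qed.

Lemma Arrow_comp (C : category) (x y z x' y' z' : C) (g : hom y z)
    (f : hom x y) (g' : hom y' z') (f' : hom x' y') :
  Arrow g = Arrow g' -> Arrow f = Arrow f' ->
  Arrow (mcomp g f) = Arrow (mcomp g' f').
Proof.
move=> gg ff.
have ez := congr1 (@tgt C) gg; have ey := congr1 (@tgt C) ff.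
have ex := congr1 (@src C) ff.
rewrite /= in ex ey ez; subst x' y' z'.
by rewrite (Arrow_inj gg) (Arrow_inj ff).
Qed.

Lemma fcomp_arrow (C D E : category) (F : functor C D) (G : functor D E)
    (K : functor C E) (a : arrow C) :
  fcomp G F = K -> functor_arrow G (functor_arrow F a) = functor_arrow K a.
Proof. by move=> <-. Qed.

Lemma invertible_fmap (D E : category) (F : functor D E) (x y : D)
    (f : hom x y) :
  invertible f -> invertible (fmap F f).
Proof.
by case=> g [gf fg]; exists (fmap F g); rewrite -!fmapM gf fg !fmap1.
Qed.

Lemma is_isomorphism_arrow_inj (C D : category) (F : functor C D) :
  is_isomorphism F -> injective (functor_arrow F).
Proof.
case=> G [GF _] a b /(congr1 (functor_arrow G)).
by rewrite !(fcomp_arrow _ GF); case: a b => [? ? ?] [? ? ?].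
Qed.

Lemma is_isomorphism_obj_inj (C D : category) (F : functor C D) :
  is_isomorphism F -> injective (fobj F).
Proof.
case=> G [GF _] x y /(congr1 (fobj G)).
by rewrite -[G (F x)]/(fcomp G F x) -[G (F y)]/(fcomp G F y) GF.
Qed.

(** * Stars and a criterion for coverings *)

Lemma inj_surj_bijective (S T : Type) (f : S -> T) :
  injective f -> (forall y, exists x, f x = y) -> bijective f.
Proof.
move=> finj fsurj; exists (fun y => sval (cid (fsurj y))) => [x|y].
  by apply: finj; case: cid.
by case: cid.
Qed.

Definition star_arrow (C : category) (c : C) (s : star c) : arrow C :=
  match s with inl s => Arrow (tagged s) | inr s => Arrow (tagged s) end.

Lemma star_arrow_map (C B : category) (F : functor C B) (c : C) (s : star c) :
  star_arrow (star_map F s) = functor_arrow F (star_arrow s).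
Proof. by case: s. Qed.

(** Bundled arrows replace the dependent pairs of the stars: injectivity concerns arrows sharing an
    endpoint, surjectivity is lifting from one prescribed endpoint. *)
Lemma is_coveringP (C B : category) (F : functor C B) :
  (forall b : B, exists c : C, F c = b) ->
  (forall a b : arrow C, src a = src b \/ tgt a = tgt b ->
     functor_arrow F a = functor_arrow F b -> a = b) ->
  (forall (c : C) (h : arrow B), src h = F c ->
     exists2 a, src a = c & functor_arrow F a = h) ->
  (forall (c : C) (h : arrow B), tgt h = F c ->
     exists2 a, tgt a = c & functor_arrow F a = h) ->
  is_covering F.
Proof.
move=> Fsurj Finj Fsrc Ftgt; split=> // c; apply: inj_surj_bijective.
- have starI (u v : star c) :
      star_map F u = star_map F v -> star_arrow u = star_arrow v.
    move=> /[dup] uv /(congr1 (@star_arrow B (F c))); rewrite !star_arrow_map.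
    (* Equal images put [u] and [v] in the same summand of the star, so their arrows share the
       source or the target [c]. *)
    apply: Finj; case: u v uv => [u|u] [v|v] //= _; by [left | right].
  move=> u v /[dup] uv /starI.
  case: u v uv => [[y f]|[y f]] [[z g]|[z g]] //= _ fg.
  + by have /= ey := congr1 (@tgt C) fg; subst z; rewrite (Arrow_inj fg).
  + by have /= ey := congr1 (@src C) fg; subst z; rewrite (Arrow_inj fg).
- case=> [] [b h].
  + have [[x y f] /= xc fh] := Fsrc c (Arrow h) erefl; subst x.
    exists (inl (existT _ y f)) => /=; congr inl.
    have /= eb := congr1 (@tgt B) fh; subst b.
    by rewrite (Arrow_inj fh).
  + have [[x y f] /= yc fh] := Ftgt c (Arrow h) erefl; subst y.
    exists (inr (existT _ x f)) => /=; congr inr.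
    have /= eb := congr1 (@src B) fh; subst b.
    by rewrite (Arrow_inj fh).
Qed.

(** * Free quotients and their universal property *)

Section OrbitCategoryTheory.
Variables (Gamma : groupType) (C : category) (act : action Gamma C).
Hypothesis free : acts_freely act.

Lemma orbit_obj_cls (w : orbits act) (x : C) : sval w x -> w = proj free x.
Proof.
case: w => w [y wE] /= wx; subst w; transitivity (cls (obj_orbit act) y).
  exact: quot_eq.
exact/obj_orbitP.
Qed.

Lemma orbit_arrow_proj (M : arrow (orbit_cat free)) (a : arrow C) :
  sval (mor M) = arrow_orbit act a ->
  sval (src M) (src a) -> sval (tgt M) (tgt a) ->
  functor_arrow (proj free) a = M.
Proof.
case: M a => w w' M [x y f] /= Mf /orbit_obj_cls ew /orbit_obj_cls ew'.
by subst w w'; congr Arrow; exact: orbit_hom_eq.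
Qed.

Lemma proj_arrow_surj (M : arrow (orbit_cat free)) :
  exists a : arrow C, functor_arrow (proj free) a = M.
Proof.
case: (proj2_sig (mor M)) => a [Ma wa wa'].
by exists a; exact: orbit_arrow_proj.
Qed.

Lemma proj_arrowP (a b : arrow C) :
  functor_arrow (proj free) a = functor_arrow (proj free) b <->
  arrow_orbit act a b.
Proof.
split=> [ab | [g ->]].
  have := congr1 (fun M : arrow (orbit_cat free) => sval (mor M)) ab.
  case: a b {ab} => x y f [z t h] /= ->; exact: arrow_orbit_refl.
apply: orbit_arrow_proj => /=.
- by rewrite arrow_orbit_act; case: a.
- by exists g^-1%g; rewrite actK.
- by exists g^-1%g; rewrite actK.
Qed.

Lemma proj_objP (x y : C) :
  proj free x = proj free y <-> exists g, y = act g x.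
Proof. exact: obj_orbitP. Qed.

Lemma proj_act (g : Gamma) : fcomp (proj free) (act g) = proj free.
Proof.
apply: functor_eq => x y f; apply/esym.
by apply/(proj_arrowP (Arrow f) (Arrow (fmap (act g) f))); exists g.
Qed.

(** [proj] is surjective on arrows, and [functor_eq] compares functors on arrows alone. *)
Lemma proj_epi (D : category) (G H : functor (orbit_cat free) D) :
  fcomp G (proj free) = fcomp H (proj free) -> G = H.
Proof.
move=> GH; apply: functor_eq => w w' M.
rewrite -[LHS]/(functor_arrow G (Arrow M)) -[RHS]/(functor_arrow H (Arrow M)).
have [a <-] := proj_arrow_surj (Arrow M).
by rewrite (fcomp_arrow _ GH) (fcomp_arrow _ erefl).
Qed.

(** Each morphism lifts to an invertible one of [C], and functors preserve invertibility. *)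
Lemma orbit_cat_groupoid :
  (forall (x y : C) (f : hom x y), invertible f) ->
  forall (w w' : orbit_cat free) (M : hom w w'), invertible M.
Proof.
move=> Cinv w w' M; have [[x y f] fM] := proj_arrow_surj (Arrow M).
have ew := congr1 (@src (orbit_cat free)) fM.
have ew' := congr1 (@tgt (orbit_cat free)) fM.
move: ew ew' => /= ew ew'; subst w w'.
by rewrite -(Arrow_inj fM); exact: (invertible_fmap (proj free) (Cinv _ _ f)).
Qed.

(** * Descent of invariant functors to the orbit category *)

Section Descent.
Variables (D : category) (F : functor C D).
Hypothesis Finv : forall g : Gamma, fcomp F (act g) = F.

Lemma invariant_obj (w : orbits act) (x : C) :
  sval w x -> F x = F (Defs.repr w).
Proof.
move=> /orbit_obj_cls wx.
have /proj_objP [g ->] : proj free x = proj free (Defs.repr w).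
  by rewrite -wx; exact/esym/Defs.reprK.
by rewrite -[in LHS](Finv g).
Qed.

(** Invariance makes [F] constant on an orbit of arrows; [invariant_obj] retypes the common value
    between the images of the chosen representatives. *)
Lemma descent_hom (w w' : orbits act) (M : orbit_hom w w') :
  exists h : hom (F (Defs.repr w)) (F (Defs.repr w')),
    forall a, sval M a -> functor_arrow F a = Arrow h.
Proof.
have [a [Ma wa wa']] := proj2_sig M.
have [h ha] := @arrow_hom D _ _ (functor_arrow F a)
  (invariant_obj wa) (invariant_obj wa').
exists h => b; rewrite Ma ha => -[g ->].
exact: (fcomp_arrow a (Finv g)).
Qed.

Definition descent_fmap (w w' : orbits act) (M : orbit_hom w w') :=
  sval (cid (descent_hom M)).

Lemma descent_fmapE (w w' : orbits act) (M : orbit_hom w w') (a : arrow C) :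
  sval M a -> functor_arrow F a = Arrow (descent_fmap M).
Proof. by rewrite /descent_fmap; case: cid => h; apply. Qed.

Definition descent : functor (orbit_cat free) D.
Proof.
refine (@Functor (orbit_cat free) D (fun w => F (Defs.repr w))
  descent_fmap _ _).
- move=> w; apply: Arrow_inj.
  have wr : sval w (Defs.repr w).
    rewrite -[X in sval X _](Defs.reprK w).
    by exists 1%g; rewrite act1.
  rewrite -(@descent_fmapE _ _ _ (Arrow (idm (Defs.repr w)))).
    by rewrite /functor_arrow /= fmap1.
  by exists (Defs.repr w).
- move=> w w' w'' N M; apply: Arrow_inj.
  (* Composable orbits have composable representatives, whose composite lies in the composite
     orbit. *)
  have [x [y [z [g [f [Ng Mf _ _ _]]]]]] := orbit_hom_pair N M.
  have {}Ng : sval N (Arrow g) by rewrite Ng; exact: arrow_orbit_refl.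
  have {}Mf : sval M (Arrow f) by rewrite Mf; exact: arrow_orbit_refl.
  rewrite -(@descent_fmapE _ _ _ (Arrow (mcomp g f))).
    rewrite /functor_arrow /= fmapM; apply: Arrow_comp.
      exact: (descent_fmapE Ng).
    exact: (descent_fmapE Mf).
  by exists x, y, z, g, f.
Defined.

Lemma descent_proj : fcomp descent (proj free) = F.
Proof.
apply: functor_eq => x y f; apply/esym.
apply: (@descent_fmapE _ _ _ (Arrow f)).
exact: arrow_orbit_refl.
Qed.

End Descent.

(** * The orbit projection as a Galois covering *)

Lemma proj_is_covering : is_covering (proj free).
Proof.
apply: is_coveringP.
- by move=> w; exists (Defs.repr w); exact: Defs.reprK.
- move=> a b ab /proj_arrowP [g bE]; subst b.
  (* [g] fixes the shared endpoint, so freeness applies. *)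
  suff -> : g = 1%g by rewrite arrow_act1.
  by case: ab => /= /esym /free.
- move=> c M Mc; have [a aM] := proj_arrow_surj M.
  (* An arbitrary lift [a] of [M] is translated by a group element carrying its source to [c]. *)
  have /proj_objP [g cE] : proj free (src a) = proj free c by rewrite -Mc -aM.
  exists (arrow_act act g a); first by rewrite /= cE.
  by rewrite -aM; apply/esym/proj_arrowP; exists g.
- move=> c M Mc; have [a aM] := proj_arrow_surj M.
  have /proj_objP [g cE] : proj free (tgt a) = proj free c by rewrite -Mc -aM.
  exists (arrow_act act g a); first by rewrite /= cE.
  by rewrite -aM; apply/esym/proj_arrowP; exists g.
Qed.

(** The fibres are the orbits of objects, and each [act g] is a deck transformation by
    [proj_act]. *)
Lemma proj_is_Galois_covering :
  connected C -> is_Galois_covering (proj free).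
Proof.
move=> conn; split=> [||w x y <- /esym/proj_objP [g yE]] //.
  exact: proj_is_covering.
by exists (act g); [exact: proj_act | rewrite yE].
Qed.

End OrbitCategoryTheory.

(** * Coverings composed with isomorphisms *)

Lemma is_isomorphism_covering (C B : category) (F : functor C B) :
  is_isomorphism F -> is_covering F.
Proof.
move=> Fiso; have [G [GF FG]] := Fiso.
have FGo (b : B) : F (G b) = b by rewrite -[LHS]/(fcomp F G b) FG.
have FGa (h : arrow B) : functor_arrow F (functor_arrow G h) = h.
  by rewrite (fcomp_arrow _ FG); case: h.
apply: is_coveringP => [b|a b _|c h hc|c h hc].
- by exists (G b).
- exact: is_isomorphism_arrow_inj.
- exists (functor_arrow G h) => //.
  by apply: (is_isomorphism_obj_inj Fiso); rewrite /= FGo.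
- exists (functor_arrow G h) => //.
  by apply: (is_isomorphism_obj_inj Fiso); rewrite /= FGo.
Qed.

Lemma is_covering_comp (C B D : category) (F : functor C B) (G : functor B D) :
  is_covering G -> is_covering F -> is_covering (fcomp G F).
Proof.
move=> [Gsurj Gbij] [Fsurj Fbij]; split=> [d|c].
  by have [b <-] := Gsurj d; have [c <-] := Fsurj b; exists c.
apply: (eq_bij (bij_comp (Gbij (F c)) (Fbij c))).
by case.
Qed.

(** [G] is injective on objects, so fibres of the composite are fibres of [F], and deck
    transformations of [F] remain deck transformations. *)
Lemma is_Galois_covering_iso (C B D : category) (F : functor C B)
    (G : functor B D) :
  is_isomorphism G -> is_Galois_covering F -> is_Galois_covering (fcomp G F).
Proof.
move=> Giso [Fcov conn Ftrans]; split=> // [|d x y <- /=].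
  exact: is_covering_comp (is_isomorphism_covering Giso) Fcov.
move=> /(is_isomorphism_obj_inj Giso) yx.
have [H FH Hx] := Ftrans _ x y erefl yx.
by exists H => //; rewrite /deck /= -fcompA FH.
Qed.

(** * Connectedness and freeness for categories of fractions *)

Lemma fractions_connected (C : category) :
  connected C -> connected (fractions C).
Proof.
case=> inhC conn; split=> // x y; elim: (conn x y) => {x y}.
- by move=> x y [f]; apply: rst_step; exists; exact: (fmap (Qcan C) f).
- by move=> x; exact: rst_refl.
- by move=> x y _; exact: rst_sym.
- by move=> x y z _ xy _; exact: rst_trans.
Qed.

(** The induced action computes to [act] on objects, so stabilisers are unchanged. *)
Lemma Qact_free (C : category) (Gamma : groupType) (act : action Gamma C) :
  acts_freely act -> acts_freely (Qact act).
Proof. by move=> free g x; exact: free. Qed.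

(** * The canonical isomorphism *)

Section Comparison.
Variables (Gamma : groupType) (C : category) (act : action Gamma C).
Hypotheses (free : acts_freely act) (freeQ : acts_freely (Qact act)).

Lemma Qmap_proj_invariant (g : Gamma) :
  fcomp (Qmap (proj free)) (Qact act g) = Qmap (proj free).
Proof. by rewrite -[RHS](congr1 _ (proj_act free g)) Qmap_comp. Qed.

Definition orbit_to_fractions :
    functor (orbit_cat freeQ) (fractions (orbit_cat free)) :=
  descent freeQ Qmap_proj_invariant.

Lemma orbit_to_fractions_proj :
  fcomp orbit_to_fractions (proj freeQ) = Qmap (proj free).
Proof. exact: descent_proj. Qed.

(** This equation determines the functor, because [proj freeQ] and [Qcan C] are epimorphic; hence
    the isomorphism is canonical. *)
Lemma orbit_to_fractions_can :
  fcomp orbit_to_fractions (fcomp (proj freeQ) (Qcan C)) =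
  fcomp (Qcan (orbit_cat free)) (proj free).
Proof. by rewrite fcompA orbit_to_fractions_proj Qmap_can. Qed.

(** [Qmap_can] turns [act g] into the induced automorphism of [fractions C], which [proj freeQ]
    absorbs. *)
Lemma proj_Qcan_invariant (g : Gamma) :
  fcomp (fcomp (proj freeQ) (Qcan C)) (act g) = fcomp (proj freeQ) (Qcan C).
Proof.
by rewrite -fcompA -Qmap_can fcompA -[Qmap _]/(aut_fun (Qact act g)) proj_act.
Qed.

(** The target is a quotient of a groupoid, hence a groupoid. *)
Lemma descent_invertible (w w' : orbit_cat free) (M : hom w w') :
  invertible (fmap (descent free proj_Qcan_invariant) M).
Proof.
exact: (orbit_cat_groupoid (@fractions_groupoid C)).
Qed.

Definition fractions_to_orbit :
    functor (fractions (orbit_cat free)) (orbit_cat freeQ) :=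
  Qlift descent_invertible.

Lemma fractions_to_orbit_can :
  fcomp fractions_to_orbit (fcomp (Qcan (orbit_cat free)) (proj free)) =
  fcomp (proj freeQ) (Qcan C).
Proof. by rewrite fcompA Qlift_can descent_proj. Qed.

(** Each composite agrees with the identity after precomposition with an epimorphic functor out of
    [C], where the two [_can] equations cancel. *)
Lemma orbit_to_fractions_iso : is_isomorphism orbit_to_fractions.
Proof.
exists fractions_to_orbit; split.
- apply: proj_epi; apply: Qcan_epi.
  by rewrite -!fcompA orbit_to_fractions_can fractions_to_orbit_can fcomp1f.
- apply: Qcan_epi; apply: proj_epi.
  by rewrite -!fcompA fractions_to_orbit_can orbit_to_fractions_can fcomp1f.
Qed.

End Comparison.

Theorem theorem3p7 (C : category) (Gamma : groupType) (act : action Gamma C)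
    (free : acts_freely act) (conn : connected C) :
  exists freeQ : acts_freely (Qact act),
    (exists Phi : functor (orbit_cat freeQ) (fractions (orbit_cat free)),
      [/\ unique
            (fun Psi : functor (orbit_cat freeQ) (fractions (orbit_cat free)) =>
               fcomp Psi (fcomp (proj freeQ) (Qcan C))
               = fcomp (Qcan (orbit_cat free)) (proj free))
            Phi,
          is_isomorphism Phi
        & fcomp Phi (proj freeQ) = Qmap (proj free)])
    /\ is_Galois_covering (Qmap (proj free)).
Proof.
exists (Qact_free free); split.
  exists (orbit_to_fractions free (Qact_free free)); split.
  - split=> [|Psi PsiE]; first exact: orbit_to_fractions_can.
    apply: proj_epi; apply: Qcan_epi.
    by rewrite -!fcompA PsiE orbit_to_fractions_can.
  - exact: orbit_to_fractions_iso.
  - exact: orbit_to_fractions_proj.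
(* This factorization reduces the claim to the projection of the free quotient of [fractions C]. *)
rewrite -(orbit_to_fractions_proj free (Qact_free free)).
apply: is_Galois_covering_iso; first exact: orbit_to_fractions_iso.
exact: proj_is_Galois_covering (fractions_connected conn).
Qed.
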